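(* Let $\mathfrak{b}\geq 1$ and let $p_1,\dots,p_k$ be patterns (nonempty finite words in the alphabet $\{0,\dots,\mathfrak{b}-1\}$), all of the same length. Let $Y=Y_{(\mathfrak{b};p_1,\dots,p_k)}$ be the subshift of finite type they describe. Then the following are equivalent: (1) There is a Borel equivariant map from $F(2^\mathbb{Z})$ to $Y$. (2) There is a continuous equivariant map from $F(2^\mathbb{Z})$ to $Y$. (3) There are integers $n,p,q$ with $\ell(p_1)\leq n<p,q$ and $\gcd(p,q)=1$, and there is a map $g\colon \Gamma_{n,p,q}\to \mathfrak{b}$ which respects $Y$. (4) For all $n\geq \ell(p_1)$ and for all sufficiently large $p,q>n$, there is a map $g\colon \Gamma_{n,p,q}\to\mathfrak{b}$ which respects $Y$.
   Context: $\mathfrak{b}=\{0,\dots,\mathfrak{b}-1\}$ with the discrete topology, and $\mathfrak{b}^\mathbb{Z}$ carries the product topology and the shift action $(s\cdot y)(n)=y(n+s)$ of $\mathbb{Z}$. A pattern $p$ is a word $p\colon\{0,\dots,\ell(p)-1\}\to\mathfrak{b}$, $\ell(p)\ge1$ its length; $p$ occurs in $y\in\mathfrak{b}^\mathbb{Z}$ if there is $n\in\mathbb{Z}$ with $y(n+i)=p(i)$ for all $0\le i<\ell(p)$. $Y_{(\mathfrak{b};p_1,\dots,p_k)}=\{y\in\mathfrak{b}^\mathbb{Z}: \text{none of } p_1,\dots,p_k \text{ occur in } y\}$. $F(2^\mathbb{Z})=\{x\in 2^\mathbb{Z}: s\cdot x\neq x \text{ for all } s\neq 0\}$ (the free part,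 a Polish space with the subspace topology). A map $f\colon F(2^\mathbb{Z})\to Y$ is equivariant if $f(s\cdot x)=s\cdot f(x)$ for all $s\in\mathbb{Z}$, $x\in F(2^\mathbb{Z})$. For integers $1\le a\le b$, $T(a,b)$ is a simple directed path with $a+b$ vertices (and $a+b-1$ edges); vertices are enumerated starting from the unique vertex of indegree $0$ following the edges. For $1\le n\le p,q$, the two-tiles graph $\Gamma_{n,p,q}$ is the directed graph obtained from the disjoint union of a copy $T_1$ of $T(n,p)$ and a copy $T_2$ of $T(n,q)$ by identifying (via the unique isomorphisms of directed paths) the four subgraphs: the subgraph of $T_1$ induced by its first $n$ vertices, the subgraph of $T_1$ induced by its last $n$ vertices, and likewise the first $n$ and last $n$ vertices of $T_2$. A map $g\colon\Gamma_{n,p,q}\to\mathfrak{b}$ respects $Y$ if for every $1\le i\le k$ and every directed path $v_1\cdots v_{\ell(p_i)}$ (of length $\ell(p_i)-1$) in $\Gamma_{n,p,q}$, the word $g(v_1)\cdots g(v_{\ell(p_i)})$ is not equal to $p_i$. *)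

(* Defs.v *)
From HB Require Import structures.
From mathcomp Require Import all_boot all_order all_algebra generic_quotient.
From mathcomp Require Import all_classical all_reals all_analysis.

Set Implicit Arguments.
Unset Strict Implicit.
Unset Printing Implicit Defensive.

Import GRing.Theory.

Local Open Scope classical_set_scope.
Local Open Scope ring_scope.
Local Open Scope quotient_scope.

Definition fullshift (b : nat) : topologicalType :=
  {ptws int -> discrete_topology 'I_b}.

Definition shift (b : nat) (s : int) (y : fullshift b) : fullshift b :=
  fun n => y (n + s).

Lemma shift_comm (b : nat) (s t : int) (y : fullshift b) :
  shift s (shift t y) = shift t (shift s y).
Proof. by apply/funext => n; rewrite /shift addrAC. Qed.

Lemma shift_inj (b : nat) (s : int) : injective (@shift b s).
Proof.
by move=> y z /funeqP e; apply/funext => n; have := e (n - s); rewrite /shift subrK.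
Qed.

Definition free_part : set (fullshift 2) :=
  [set x | forall s : int, s != 0 -> shift s x <> x].

Definition occurs (b : nat) (p : seq 'I_b) (y : fullshift b) : Prop :=
  exists n : int, forall i : 'I_(size p),
    y (n + (i : nat)%:Z) = tnth (in_tuple p) i.

Definition sft (b k : nat) (w : 'I_k -> seq 'I_b) : set (fullshift b) :=
  [set y | forall i, ~ occurs (w i) y].

Definition shift_invariant (b : nat) (A : set (fullshift b)) : Prop :=
  forall (s : int) (y : fullshift b), A y -> A (shift s y).

Lemma free_part_invariant : shift_invariant free_part.
Proof. by move=> s x Fx t /Fx nx; rewrite shift_comm => /shift_inj. Qed.

Lemma sft_invariant (b k : nat) (w : 'I_k -> seq 'I_b) :
  shift_invariant (sft w).
Proof.
move=> s y Yy i [n ny]; apply: (Yy i); exists (n + s) => j.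
by rewrite -ny /shift addrAC.
Qed.

Definition shift_on (b : nat) (A : set (fullshift b))
    (invA : shift_invariant A) (s : int) (x : A) : A :=
  exist _ (shift s (set_val x)) (mem_set (invA s _ (set_mem (valP x)))).

Definition equivariant (b k : nat) (w : 'I_k -> seq 'I_b)
    (f : free_part -> sft w) : Prop :=
  forall (s : int) (x : free_part),
    f (shift_on free_part_invariant s x) =
    shift_on (@sft_invariant b k w) s (f x).

(* Stated on the generated sigma-algebras directly: the library only makes
   [g_sigma_algebraType] a measurable space for pointed types. *)
Definition borel_map (X Y : topologicalType) (f : X -> Y) : Prop :=
  forall B : set Y, <<s open >> B -> <<s open >> (f @^-1` B).

(* The path T(a, b): vertex [i] is the one at position [i] from the source. *)
Definition tile (a b : nat) : finType := 'I_(a + b).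

Definition tile_edge (a b : nat) : rel (tile a b) :=
  fun i j => j == i.+1 :> nat.

Section TwoTiles.
Variables n p q : nat.

Definition two_tiles_pre : finType := (tile n p + tile n q)%type.

Definition two_tiles_pre_edge : rel two_tiles_pre := fun u v =>
  match u, v with
  | inl i, inl j => tile_edge i j
  | inr i, inr j => tile_edge i j
  | _, _ => false
  end.

(* [v] is the [j]-th vertex of one of the four copies of the n-vertex path:
   the first n or the last n vertices of one of the two tiles. *)
Definition block_vertex (j : 'I_n) (v : two_tiles_pre) : bool :=
  match v with
  | inl i => (i == j :> nat) || (i == (p + j)%N :> nat)
  | inr i => (i == j :> nat) || (i == (q + j)%N :> nat)
  end.

Definition tile_glue : rel two_tiles_pre := fun u v =>
  [exists j : 'I_n, block_vertex j u && block_vertex j v].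

Lemma tile_glue_sym : symmetric tile_glue.
Proof. by move=> u v; apply: eq_existsb => j; rewrite andbC. Qed.

(* [connect] is the reflexive transitive closure, so this is the equivalence
   relation generated by [tile_glue]. *)
Definition tile_glue_equiv : equiv_rel two_tiles_pre :=
  EquivRel (connect tile_glue) (connect0 tile_glue) (sym_connect_sym tile_glue_sym)
    (@connect_trans _ tile_glue).

Definition two_tiles : eqType := {eq_quot tile_glue_equiv}.

Definition two_tiles_edge : rel two_tiles := fun x y =>
  [exists u : two_tiles_pre, exists v : two_tiles_pre,
    [&& two_tiles_pre_edge u v, \pi_{eq_quot tile_glue_equiv} u == x
      & \pi_{eq_quot tile_glue_equiv} v == y]].

Definition respects (b k : nat) (w : 'I_k -> seq 'I_b)
    (g : two_tiles -> 'I_b) : Prop :=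
  forall (i : 'I_k) (s : seq two_tiles),
    size s = size (w i) -> sorted two_tiles_edge s -> map g s <> w i.

End TwoTiles.

(* Main.v *)
(** A map respecting the subshift on the two-tiles graph amounts to a word [u] of
    length [n] together with admissible words of lengths [n + p] and [n + q]
    that both start and end with [u], that is, loops of lengths [p] and [q]
    at [u]. Loops at [u] can be concatenated, so loops of coprime lengths give
    loops of all large lengths.

    From a Borel equivariant [f] to loops: by a category argument there are a
    cylinder [C] and a word [u] such that [f x] starts with [u] for generic
    [x] in [C]. For [m] large, [C] and its translate by [m] are independent, so
    a generic [x] in both exists, and [f x] carries [u] at [0] and at [m].

    From loops of all large lengths to a continuous [f]: the free part has a
    clopen set of markers with large and finite gaps on every orbit; a gap of
    length [m] is filled with a loop of length [m] at [u]. *)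

From mathcomp Require Import all_boot all_order all_algebra generic_quotient zify.
From mathcomp Require Import all_classical all_reals all_analysis.
(* After mathcomp-analysis, whose own [shift] would hide the shift action. *)
Require Import Defs.

Import GRing.Theory.

(** * Cylinders of the full shift *)

Section Cylinders.
Set Implicit Arguments.
Unset Strict Implicit.
Unset Printing Implicit Defensive.
Local Open Scope classical_set_scope.
Local Open Scope ring_scope.
Context {b : nat}.
Implicit Types (x y z : fullshift b) (r : nat) (s : int).

(** [agree r x] is the cylinder of radius [r] around [x]; these cylinders form a base of the
    topology. *)
Definition agree r x y := forall n : int, (`|n| <= r)%N -> x n = y n.

Lemma agree_sym r x y : agree r x y -> agree r y x.
Proof. by move=> xy n /xy. Qed.

Lemma agree_trans r x y z : agree r x y -> agree r y z -> agree r x z.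
Proof. by move=> xy yz n nr; rewrite xy // yz. Qed.

Lemma agree_le r r' x y : (r <= r')%N -> agree r' x y -> agree r x y.
Proof. by move=> rr xy n nr; apply: xy; apply: leq_trans rr. Qed.

Lemma agree_shift r s x y :
  agree (r + `|s|) x y -> agree r (shift s x) (shift s y).
Proof. by move=> xy n nr; apply: xy; lia. Qed.

Lemma shiftD s t x : shift s (shift t x) = shift (s + t) x.
Proof. by apply/funext => n; rewrite /shift addrA. Qed.

Lemma shift0 x : shift 0 x = x.
Proof. by apply/funext => n; rewrite /shift addr0. Qed.

Lemma agree_filter x : Filter [set S | exists r, forall y, agree r x y -> S y].
Proof.
split; first by exists 0%N.
  move=> A B [r rA] [r' rB]; exists (maxn r r') => y xy; split.
    by apply: rA; apply: agree_le xy; rewrite leq_maxl.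
  by apply: rB; apply: agree_le xy; rewrite leq_maxr.
by move=> A B sAB [r rA]; exists r => y /rA /sAB.
Qed.

Lemma nbhs_coord x (n : int) : nbhs x [set y : fullshift b | y n = x n].
Proof.
have /cvg_sup/(_ n) xn : nbhs x --> x by apply: cvg_id.
apply: xn; exists [set y : fullshift b | y n = x n]; split => //=.
exists [set x n]; last by [].
exact: discrete_open.
Qed.

Lemma nbhs_fullshift x (S : set (fullshift b)) :
  nbhs x S <-> exists r, forall y, agree r x y -> S y.
Proof.
split => [|[r]]; last first.
  move=> xS; suff : nbhs x (agree r x) by apply: filterS.
  elim: r {xS} => [|r IH].
    apply: filterS (nbhs_coord x 0) => y /= e n n0.
    by have -> : n = 0 by lia.
  have nI := @filterI (fullshift b) _ (nbhs_filter x).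
  have nx := nI _ _ IH (nI _ _ (nbhs_coord x r.+1%:Z) (nbhs_coord x (- r.+1%:Z))).
  apply: filterS nx => y [/= xy [e1 e2]] n nr.
  have [/xy//|rn] := leqP `|n| r.
  by have [->|->] : n = r.+1%:Z \/ n = - r.+1%:Z by lia.
(* The topology is the supremum of those pulled back along the coordinates, so the filter generated
   by the cylinders around [x] only has to converge coordinatewise. *)
have xF := agree_filter x.
suff h : cvg_to [set S | exists r, forall y, agree r x y -> S y] (nbhs x).
  exact: h.
apply/(@cvg_sup _ _ _ _ _ xF) => n A [_ [[B oB <-] /= Bx sBA]].
by exists `|n|%N => y xy; apply: sBA => /=; rewrite -xy.
Qed.

Lemma nbhs_set_type {A : set (fullshift b)} (x : A) (S : set A) :
  nbhs x S <-> exists r, forall y : A, agree r (set_val x) (set_val y) -> S y.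
Proof.
split=> [[_ [[U oU <-] /= Ux sUS]]|[r xS]].
  have /nbhs_fullshift[r xU] : nbhs (set_val x) U by apply: open_nbhs_nbhs.
  by exists r => y xy; apply: sUS; apply: xU.
have nx : nbhs (set_val x) (agree r (set_val x)).
  by apply/nbhs_fullshift; exists r.
move: (initial_continuous nx) => xr.
by apply: (@filterS A _ (nbhs_filter x) _ _ _ xr) => y; apply: xS.
Qed.

End Cylinders.

(** * Baire category on the free part *)

Section Category.
Set Implicit Arguments.
Unset Strict Implicit.
Unset Printing Implicit Defensive.
Local Open Scope classical_set_scope.
Local Open Scope ring_scope.
Implicit Types (x y : fullshift 2) (r : nat) (s : int) (O : set (fullshift 2)).

(** Equivalent to containing a dense open set; phrased with nested cylinders, it can be iterated
    directly. *)
Definition dense_interior O := forall x r,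
  exists x' r', [/\ (r <= r')%N, agree r x x' & agree r' x' `<=` O].

Lemma dense_interiorT : dense_interior setT.
Proof. by move=> x r; exists x, r. Qed.

Lemma dense_interiorI O O' :
  dense_interior O -> dense_interior O' -> dense_interior (O `&` O').
Proof.
move=> dO dO' x r; have [x1 [r1 [rr1 xx1 sO]]] := dO x r.
have [x2 [r2 [rr2 xx2 sO']]] := dO' x1 r1; exists x2, r2; split.
- exact: leq_trans rr2.
- by apply: agree_trans xx1 _; apply: agree_le xx2.
- move=> y y2; split; last exact: sO'.
  by apply: sO; apply: agree_trans xx2 _; apply: agree_le y2.
Qed.

Lemma dense_interior_shift s O :
  dense_interior O -> dense_interior (@shift 2 s @^-1` O).
Proof.
move=> dO x r; have [x' [r' [rr' xx' sO]]] := dO (shift s x) (r + `|s|)%N.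
exists (shift (- s) x'), (r' + `|s|)%N; split; first by lia.
  have := @agree_shift _ r (- s) (shift s x) x'.
  by rewrite shiftD addNr shift0 abszN; apply.
move=> y y'; apply: sO; have := agree_shift y'.
by rewrite shiftD subrr shift0.
Qed.

Lemma aperiodic_dense s : s != 0 -> dense_interior [set x | shift s x <> x].
Proof.
move=> s0 x r.
(* The sign of [p] follows that of [s], so [p] and [p + s] both lie outside the window of radius [r]
   and can receive distinct letters. *)
pose p : int := if 0 < s then r.+1%:Z else - r.+1%:Z.
pose x' : fullshift 2 := fun n =>
  if (`|n| <= r)%N then x n else if n == p then ord0 else ord_max.
exists x', (r.+1 + `|s|)%N; split; first by lia.
  by move=> n nr; rewrite /x' nr.
move=> y x'y /= /(congr1 (fun z : fullshift 2 => z p)).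
rewrite /shift -!x'y; [|by rewrite /p; case: ifP; lia..].
rewrite /x' eqxx.
have -> : (`|(p + s)%R| <= r)%N = false by rewrite /p; case: ifP; lia.
have -> : (`|p| <= r)%N = false by rewrite /p; case: ifP; lia.
by have -> : (p + s == p) = false by apply/eqP; lia.
Qed.

Lemma baire (G_ : nat -> set (fullshift 2)) x r :
  (forall k, dense_interior (G_ k)) ->
  exists2 y, agree r x y & forall k, G_ k y.
Proof.
move=> dO.
have /choice[F HF] : forall kp : nat * (fullshift 2 * nat),
    exists q : fullshift 2 * nat,
    [/\ (kp.2.2 < q.2)%N, agree kp.2.2 kp.2.1 q.1
      & agree q.2 q.1 `<=` G_ kp.1].
  move=> [k [x1 r1]] /=; have [x2 [r2 [r12 x12 sO]]] := dO k x1 r1.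
  (* The extra 1 makes the radii strictly increasing, so that the cylinders shrink to a single
     point. *)
  exists (x2, r2.+1); split=> //= y x2y; apply: sO; exact: agree_le x2y.
pose c := fix c k := if k is k'.+1 then F (k', c k') else (x, r).
have cS k : c k.+1 = F (k, c k) by [].
have c_ge k : (k <= (c k).2)%N.
  elim: k => // k IH; rewrite cS; have [/= h _ _] := HF (k, c k).
  exact: leq_ltn_trans IH h.
have c_agree j k : agree (c k).2 (c k).1 (c (k + j)%N).1 /\
    ((c k).2 <= (c (k + j)%N).2)%N.
  elim: j => [|j [IH1 IH2]]; first by rewrite addn0.
  rewrite addnS cS; have [/= h1 h2 _] := HF ((k + j)%N, c (k + j)%N).
  split; last exact: leq_trans IH2 (ltnW h1).
  by apply: agree_trans IH1 _; apply: agree_le IH2 h2.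
(* The limit point: the cylinder of index [|n|] has radius at least [|n|], so all later ones agree
   with it at [n]. *)
pose y : fullshift 2 := fun n => (c `|n|%N).1 n.
have cy k : agree (c k).2 (c k).1 y.
  move=> n nk; rewrite /y; have [kn|/ltnW kn] := leqP k `|n|.
    by have [h _] := c_agree (`|n| - k)%N k; rewrite h // subnKC.
  have [h _] := c_agree (k - `|n|)%N `|n|%N.
  by rewrite h ?subnKC //; apply: c_ge.
exists y; first exact: (cy 0).
by move=> k; have [_ _] := HF (k, c k); apply; rewrite -cS.
Qed.

(** The free part is itself a countable intersection of sets with dense interior, which can be added
    to the given ones. *)
Lemma baire_free (G_ : nat -> set (fullshift 2)) x r :
  (forall k, dense_interior (G_ k)) ->
  exists2 z : free_part, agree r x (set_val z) & forall k, G_ k (set_val z).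
Proof.
move=> dO.
pose A k := [set y : fullshift 2 |
  if unpickle k is Some s then s != 0 -> shift s y <> y else True].
have dA k : dense_interior (A k).
  rewrite /A; case: unpickle => [s|]; last exact: dense_interiorT.
  have [->|s0] := eqVneq s 0.
    by move=> x' r'; exists x', r'; split=> // y _ /=; rewrite eqxx.
  move=> x1 r1; have [x2 [r2 [? ? h]]] := aperiodic_dense s0 x1 r1.
  by exists x2, r2; split=> // y /h yh _; exact: yh.
have [y xy yO] := baire x r
  (fun k => dense_interiorI (dO k) (dA k)).
have Fy : free_part y.
  by move=> s s0; have [_] := yO (pickle s); rewrite /A /= pickleK; apply.
by exists (exist _ y (mem_set Fy)) => // k; have [] := yO k.
Qed.

(** A cylinder of radius [r] is determined by a word of length [2r + 1], and there are countably
    many words. *)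
Lemma cylinder_enum : exists c : nat -> fullshift 2 * nat,
  forall x r, exists2 i, (c i).2 = r & agree r x (c i).1.
Proof.
pose g (q : seq 'I_2 * nat) : fullshift 2 * nat :=
  ((fun n => nth ord0 q.1 `|n + q.2%:Z|) : fullshift 2, q.2).
exists (fun i => g (odflt ([::], 0%N) (unpickle i))) => x r.
exists (pickle (mkseq (fun k => x (k%:Z - r%:Z) : 'I_2) (r + r).+1, r)).
  by rewrite pickleK.
rewrite pickleK /= => n nr; rewrite nth_mkseq; last by lia.
by congr x; lia.
Qed.

(** [S] is comeager in the trace of the cylinder on the free part. The sets [G_ k] live in the full
    shift, where [baire_free] applies to them. *)
Definition generic_in r x (S : set free_part) :=
  exists2 G_ : nat -> set (fullshift 2), forall k, dense_interior (G_ k)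
  & forall z : free_part,
      agree r x (set_val z) -> (forall k, G_ k (set_val z)) -> S z.

Lemma sub_generic r x (S S' : set free_part) :
  S `<=` S' -> generic_in r x S -> generic_in r x S'.
Proof. by move=> SS' [G_ dO OS]; exists G_ => // z xz /(OS z xz) /SS'. Qed.

Lemma generic_le {r r' x x'} {S : set free_part} :
  (r <= r')%N -> agree r x x' -> generic_in r x S -> generic_in r' x' S.
Proof.
move=> rr xx [G_ dO OS]; exists G_ => // z xz; apply: OS.
by apply: agree_trans xx _; apply: agree_le xz.
Qed.

Lemma generic_cylinder r x (S : set free_part) :
  (forall z : free_part, agree r x (set_val z) -> S z) -> generic_in r x S.
Proof.
by move=> xS; exists (fun=> setT) => [_|z /xS//]; apply: dense_interiorT.
Qed.

Lemma generic_bigcap r x (S : nat -> set free_part) :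
  (forall i, generic_in r x (S i)) -> generic_in r x (\bigcap_i S i).
Proof.
move=> xS; have /choice[G_ HO] : forall i,
    exists G_ : nat -> set (fullshift 2),
    (forall k, dense_interior (G_ k)) /\ forall z : free_part,
      agree r x (set_val z) -> (forall k, G_ k (set_val z)) -> S i z.
  by move=> i; have [G_ ? ?] := xS i; exists G_.
exists (fun k => if unpickle k is Some ij then G_ ij.1 ij.2 else setT).
  move=> k; case: unpickle => [[i j]|]; last exact: dense_interiorT.
  by have [] := HO i.
move=> z xz zO i _; have [_] := HO i; apply=> // j.
by have := zO (pickle (i, j)); rewrite pickleK.
Qed.

(** Localization of category: the enumerated cylinders in which [S] is generic are dense in the
    given one, and their countably many witnessing sequences merge into one. *)
Lemma generic_locally r x (S : set free_part) :
  (forall x' r', (r <= r')%N -> agree r x x' ->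
    exists x'' r'', [/\ (r' <= r'')%N, agree r' x' x'' & generic_in r'' x'' S]) ->
  generic_in r x S.
Proof.
move=> loc; have [c cP] := cylinder_enum.
have /choice[G_ HO] : forall i, exists G_ : nat -> set (fullshift 2),
    (forall k, dense_interior (G_ k)) /\
    (generic_in (c i).2 (c i).1 S -> forall z : free_part,
      agree (c i).2 (c i).1 (set_val z) ->
      (forall k, G_ k (set_val z)) -> S z).
  move=> i; have [[G_ ? ?]|ncS] := pselect (generic_in (c i).2 (c i).1 S).
    by exists G_.
  by exists (fun=> setT); split=> // k; apply: dense_interiorT.
(* As an implication, [V] contains everything outside the given cylinder and so has dense interior
   in the whole shift. *)
pose V := [set y | agree r x y ->
  exists2 i, generic_in (c i).2 (c i).1 S & agree (c i).2 (c i).1 y].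
have dV : dense_interior V.
  move=> x0 r0.
  have [[y xy x0y]|disj] := pselect (exists2 y, agree r x y & agree r0 x0 y).
    have [|x2 [r2 [mr yx2 gS]]] := loc y (maxn r r0) (leq_maxl _ _).
      exact: xy.
    have [i ci xi] := cP x2 r2; exists x2, r2; split.
    - by apply: leq_trans mr; rewrite leq_maxr.
    - by apply: agree_trans x0y _; apply: agree_le yx2; rewrite leq_maxr.
    - move=> y' y'2 _; exists i; first by apply: generic_le gS; rewrite ?ci.
      by rewrite ci; apply: agree_trans (agree_sym xi) y'2.
  by exists x0, r0; split=> // y x0y xy; case: disj; exists y.
exists (fun k => if k is k'.+1 then
    (if unpickle k' is Some ij then G_ ij.1 ij.2 else setT) else V).
  case=> // k; case: unpickle => [[i j]|]; last exact: dense_interiorT.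
  by have [] := HO i.
move=> z xz zO; have [i ci zi] := zO 0 xz.
have [_] := HO i; apply=> // j.
by have := zO (pickle (i, j)).+1; rewrite pickleK.
Qed.

(* A substitute for the Baire property that avoids choosing the open set. *)
Definition decided (S : set free_part) := forall x r,
  exists x' r', [/\ (r <= r')%N, agree r x x'
    & generic_in r' x' S \/ generic_in r' x' (~` S)].

(** For a countable union, either some member is generic in a smaller cylinder, or every complement
    is generic in a dense family of cylinders; localization then makes the intersection of the
    complements generic. *)
Lemma decided_sigma_algebra : sigma_algebra setT decided.
Proof.
split.
- move=> x r; exists x, r; split=> //; right; apply: generic_cylinder.
  by move=> z _ [].
- move=> A dA x r; have [x' [r' [rr xx xA]]] := dA x r.
  exists x', r'; split=> //; rewrite setTD setCK; tauto.
- move=> A dA x r.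
  have [[k [x' [r' [rr xx xA]]]]|none] := pselect (exists k x' r',
      [/\ (r <= r')%N, agree r x x' & generic_in r' x' (A k)]).
    exists x', r'; split=> //; left; apply: sub_generic xA.
    exact: bigcup_sup.
  exists x, r; split=> //; right; rewrite setC_bigcup; apply: generic_bigcap => k.
  apply: generic_locally => x1 r1 r01 x01.
  have [x2 [r2 [r12 x12 [xA|xA]]]] := dA k x1 r1; last by exists x2, r2.
  case: none; exists k, x2, r2; split=> //; first exact: leq_trans r12.
  by apply: agree_trans x01 _; apply: agree_le x12.
Qed.

Lemma open_decided (S : set free_part) : open S -> decided S.
Proof.
move=> oS x r.
have [[z xz Sz]|xS] :=
    pselect (exists2 z : free_part, agree r x (set_val z) & S z).
  have /nbhs_set_type[r1 zS] : nbhs z S by apply: open_nbhs_nbhs.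
  exists (set_val z), (maxn r r1); split; rewrite ?leq_maxl //.
  left; apply: generic_cylinder => z' zz'; apply: zS.
  by apply: agree_le zz'; rewrite leq_maxr.
exists x, r; split=> //; right; apply: generic_cylinder => z xz Sz.
by apply: xS; exists z.
Qed.

Lemma borel_decided (S : set free_part) : <<s open >> S -> decided S.
Proof. exact: (smallest_sub decided_sigma_algebra open_decided). Qed.

(** Otherwise each value would be avoided generically, and Baire would give a point avoiding all the
    countably many values. *)
Lemma generic_value (T : countType) (h : free_part -> T) :
  (forall t, decided (h @^-1` [set t])) ->
  exists x r t, generic_in r x (h @^-1` [set t]).
Proof.
move=> dh; apply: contrapT => none.
pose x0 : fullshift 2 := fun=> ord0.
have nt t : generic_in 0 x0 (~` (h @^-1` [set t])).
  apply: generic_locally => x r _ _.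
  have [x' [r' [rr xx [xt|xt]]]] := dh t x r; last by exists x', r'.
  by case: none; exists x', r', t.
have := @generic_bigcap 0 x0
  (fun k => if unpickle k is Some t then ~` (h @^-1` [set t]) else setT).
case=> [k|].
  by case: unpickle => [t|]; [exact: nt | exact: generic_cylinder].
move=> G_ dO OS.
have [z x0z zO] := baire_free x0 0 dO.
by have := OS z x0z zO (pickle (h z)) I; rewrite pickleK; apply.
Qed.

(* If [f z] has prefix [u] for generic [z] in a cylinder [C], then for large [m]
   the open set of [z] with both [z] and [shift m z] in [C] is nonempty. *)
Lemma borel_recurrence (b k : nat) (w : 'I_k -> seq 'I_b)
    (f : free_part -> sft w) (n : nat) :
  borel_map f -> equivariant f ->
  exists (u : 'I_n -> 'I_b) N, forall m, (N <= m)%N -> exists y : sft w,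
    forall i : 'I_n, set_val y i%:Z = u i /\ set_val y (m%:Z + i%:Z) = u i.
Proof.
move=> bf ef.
pose h (z : free_part) : {ffun 'I_n -> 'I_b} :=
  [ffun i : 'I_n => set_val (f z) i%:Z].
have [u|x [r [u [G_ dO Ou]]]] := @generic_value _ h.
  apply: borel_decided.
  pose B := [set y : sft w | forall i : 'I_n, set_val y i%:Z = u i].
  have -> : h @^-1` [set u] = f @^-1` B.
    apply/seteqP; split => z; first by move=> e i; rewrite -e ffunE.
    by move=> e; apply/ffunP => i; rewrite ffunE; exact: e.
  apply: bf; apply: sub_sigma_algebra; rewrite openE => y By.
  apply/nbhs_set_type; exists n => y' yy' i.
  by rewrite -yy' //=; apply: ltnW.
(* From [2r + 1] on, the windows of radius [r] around 0 and around [m] are disjoint, so [x0] can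
   carry a copy of [x] on both. *)
exists u, (r + r).+1 => m rm.
pose x0 : fullshift 2 := fun j => if j <= r%:Z then x j else x (j - m%:Z).
have [z x0z zO] := baire_free x0 (r + m)%N
  (fun j => dense_interiorI (dO j) (dense_interior_shift m%:Z (dO j))).
exists (f z).
have hz : h z = u.
  apply: Ou => [j jr|j]; last by have [] := zO j.
  by rewrite -x0z; [rewrite /x0; have -> : j <= r by lia|lia].
have hmz : h (shift_on free_part_invariant m%:Z z) = u.
  apply: Ou => [j jr|j]; last by have [] := zO j.
  rewrite -[RHS]/(set_val z (j + m%:Z)) -x0z; [rewrite /x0|lia].
  by have -> : (j + m%:Z <= r) = false by [lia]; rewrite addrK.
move=> i; split; first by rewrite -hz ffunE.
by rewrite -hmz ffunE ef /= /shift addrC.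
Qed.

End Category.

(** * Loops and two-tiles graphs *)

Section Loops.
Set Implicit Arguments.
Unset Strict Implicit.
Unset Printing Implicit Defensive.
Local Open Scope quotient_scope.
Context {b k : nat} {w : 'I_k -> seq 'I_b} {L : nat}.
Hypothesis sizew : forall i, size (w i) = L.

Definition avoids (a : nat -> 'I_b) (j : nat) :=
  forall i, mkseq (fun t => a (j + t)) (size (w i)) <> w i.

Lemma avoids_eq (a a' : nat -> 'I_b) j j' :
  (forall t, t < L -> a (j + t) = a' (j' + t)) -> avoids a j -> avoids a' j'.
Proof.
move=> e aj i wi; apply: (aj i); rewrite -[RHS]wi.
by apply/eq_in_map => t; rewrite mem_iota sizew => /andP[_ /e].
Qed.

(* [u] is a word of length [n], only its values below [n] matter; the windows
   of [a] starting at or after [m] are windows of [u]. *)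
Definition loop_at (n : nat) (u : nat -> 'I_b) (m : nat) :=
  exists a : nat -> 'I_b,
    [/\ forall t, t < n -> a t = u t, forall t, t < n -> a (m + t) = u t
      & forall j, j < m -> avoids a j].

Lemma loop0 n u : loop_at n u 0.
Proof. by exists u. Qed.

(** The two loops overlap in the [n] letters of [u]. As [L <= n], each window lies entirely within
    one of them. *)
Lemma loopD n u m m' : L <= n ->
  loop_at n u m -> loop_at n u m' -> loop_at n u (m + m').
Proof.
move=> Ln [a [a0 am aok]] [a' [a'0 a'm a'ok]].
pose c t := if t < m then a t else a' (t - m).
have ca t : t < m + n -> c t = a t.
  move=> tmn; rewrite /c; case: ltnP => // mt.
  have tn : t - m < n by lia.
  by rewrite a'0 // -am // subnKC.
have ca' t : c (m + t) = a' t.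
  by rewrite /c ltnNge leq_addr /= addKn.
exists c; split=> [t tn|t tn|j jm].
- by rewrite ca ?a0 //; lia.
- by rewrite -addnA ca' a'm.
have [jm'|mj] := ltnP j m.
  by apply: avoids_eq (aok j jm') => t tL; rewrite ca //; lia.
have {}jm : j - m < m' by lia.
apply: avoids_eq (a'ok _ jm) => t tL.
by rewrite -ca'; congr c; lia.
Qed.

Lemma loopM n u m c : L <= n -> loop_at n u m -> loop_at n u (c * m).
Proof.
move=> Ln um; elim: c => [|c IH]; first exact: loop0.
by rewrite mulSn; apply: loopD.
Qed.

Lemma loop_coprime n u p q m : L <= n -> 0 < p -> 0 < q -> coprime p q ->
  loop_at n u p -> loop_at n u q -> p * q <= m -> loop_at n u m.
Proof.
move=> Ln p0 q0 pq up uq pqm.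
have pq0 : 0 < p * q by rewrite muln_gt0 p0.
(* [c] is divisible by [p], congruent to [m] modulo [q] and less than [p * q <= m]; hence [m] is a
   multiple of [p] plus a multiple of [q]. *)
pose c := chinese p q 0 m %% (p * q).
have cpq : c < p * q by rewrite ltn_mod.
have pc : p %| c.
  rewrite /dvdn /c modn_dvdm ?dvdn_mulr //.
  by rewrite (chinese_modl pq) mod0n.
have qc : q %| m - c.
  rewrite -eqn_mod_dvd; last by lia.
  by rewrite /c modn_dvdm ?dvdn_mull // (chinese_modr pq).
have -> : m = c %/ p * p + (m - c) %/ q * q.
  by rewrite (divnK pc) (divnK qc) subnKC //; lia.
by apply: loopD => //; apply: loopM.
Qed.

(** * Directed paths in the two-tiles graph *)

Section Graph.
Variables n p q : nat.
Hypotheses (np : n < p) (nq : n < q).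

(** The boolean names the tile, [true] for the one of parameter [p], so that both tiles are treated
    at once. *)
Let len (c : bool) := if c then p else q.

Let len_gt c : n < len c. Proof. by case: c. Qed.

Let np0 : 0 < n + p. Proof. by lia. Qed.
Let nq0 : 0 < n + q. Proof. by lia. Qed.

Let vertex (c : bool) (t : nat) : two_tiles_pre n p q :=
  if c then inl (insubd (Ordinal np0) t) else inr (insubd (Ordinal nq0) t).

Let vertexP v : exists c t, t < n + len c /\ v = vertex c t.
Proof.
case: v => i; [exists true|exists false]; exists i; split=> //=;
  by congr (_ _); apply: val_inj; rewrite val_insubd ltn_ord.
Qed.

Let edge_vertex c t : t.+1 < n + len c ->
  two_tiles_pre_edge (vertex c t) (vertex c t.+1).
Proof.
by case: c => /= h; rewrite /tile_edge /= !val_insubd h (ltnW h).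
Qed.

Let edgeP u v : two_tiles_pre_edge u v ->
  exists c t, [/\ t.+1 < n + len c, u = vertex c t & v = vertex c t.+1].
Proof.
case: u v => i [] j //= /eqP ij; [exists true|exists false];
  exists i; rewrite /= -ij ltn_ord; split=> //=;
  by congr (_ _); apply: val_inj; rewrite val_insubd ltn_ord.
Qed.

Let block_vertexE c t (j : 'I_n) : t < n + len c ->
  block_vertex j (vertex c t) = (t == j) || (t == len c + j).
Proof. by case: c => /= h; rewrite val_insubd h. Qed.

(** Reading [g] along a tile gives a loop: by the gluing both tiles start and end with the same
    word, and windows in a tile are directed paths. *)
Lemma respects_loops (g : two_tiles n p q -> 'I_b) : L <= n -> respects w g ->
  exists u, loop_at n u p /\ loop_at n u q.
Proof.
move=> Ln rg.
pose a c t := g (\pi_(two_tiles n p q) (vertex c t)).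
have glue c t c' t' (j : 'I_n) : t < n + len c -> t' < n + len c' ->
    (t == j) || (t == len c + j) -> (t' == j) || (t' == len c' + j) ->
    a c t = a c' t'.
  move=> tc tc' tj tj'; congr g; apply/eqmodP; apply: connect1.
  by apply/existsP; exists j; rewrite !block_vertexE // tj tj'.
have loopa c : loop_at n (a true) (len c).
  have lc := len_gt c; have lt := len_gt true.
  exists (a c); split=> [t tn|t tn|j jp i wi].
  - by apply: (glue _ _ _ _ (Ordinal tn)) => /=; rewrite ?eqxx //; lia.
  - by apply: (glue _ _ _ _ (Ordinal tn)) => /=; rewrite ?eqxx ?orbT //; lia.
  pose v t := \pi_(two_tiles n p q) (vertex c (j + t)).
  apply: (rg i (mkseq v (size (w i)))); rewrite ?size_mkseq //.
    apply/(sortedP (v 0)) => t; rewrite size_mkseq => ti.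
    rewrite !nth_mkseq; [|lia..].
    apply/existsP; exists (vertex c (j + t)); apply/existsP.
    exists (vertex c (j + t.+1)); rewrite !eqxx !andbT addnS.
    by apply: edge_vertex; rewrite sizew in ti; lia.
  by rewrite -[RHS]wi /mkseq -map_comp.
by exists (a true); split; [apply: (loopa true)|apply: (loopa false)].
Qed.

(* [(None, t)]: vertex [t] of the common block; [(Some c, t)]: vertex [t] of
   tile [c] outside of its two blocks. *)
Let nrm (c : bool) (t : nat) : option bool * nat :=
  if t < n then (None, t) else
  if len c <= t then (None, t - len c) else (Some c, t).

Let nrmv (v : two_tiles_pre n p q) :=
  match v with inl i => nrm true i | inr i => nrm false i end.

Let nrmv_vertex c t : t < n + len c -> nrmv (vertex c t) = nrm c t.
Proof. by case: c => /= h; rewrite val_insubd h. Qed.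

Let nrmv_glue u v : tile_glue u v -> nrmv u = nrmv v.
Proof.
move=> /existsP[j /andP[]]; have [c [t [tc ->]]] := vertexP u.
have [c' [t' [tc' ->]]] := vertexP v.
rewrite !block_vertexE // !nrmv_vertex //.
have block d s : s < n + len d -> (s == j) || (s == len d + j) ->
    nrm d s = (None, val j).
  move=> sd; have jn := ltn_ord j; have dn := len_gt d.
  by move=> /orP[]/eqP ->; rewrite /nrm ?jn // ltnNge leq_addr addKn
    (leq_trans (ltnW dn) (leq_addr _ _)).
by move=> /(block _ _ tc) -> /(block _ _ tc') ->.
Qed.

(** Induction along a chain of gluings: the normal form is well defined on the quotient. *)
Let nrmv_repr v : nrmv (repr (\pi_(two_tiles n p q) v)) = nrmv v.
Proof.
have rv : tile_glue_equiv n p q (repr (\pi_(two_tiles n p q) v)) v.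
  by apply/eqmodP; rewrite reprK.
have /connectP[s] : connect (@tile_glue n p q) (repr (\pi_(two_tiles n p q) v)) v.
  exact: rv.
elim: s (repr _) => [|y s IH] x /= => [_ -> //|/andP[/nrmv_glue -> ys] e].
exact: IH.
Qed.

Let nrm_inner c t : n <= t -> t < len c -> nrm c t = (Some c, t).
Proof. by rewrite /nrm => nt tc; rewrite ltnNge nt leqNgt tc. Qed.

Let nrm_block c t : t < n -> nrm c t = (None, t).
Proof. by rewrite /nrm => ->. Qed.

Let nrm_last c t : nrm c (len c + t) = (None, t).
Proof.
rewrite /nrm leq_addr addKn.
by rewrite ltnNge (leq_trans (ltnW (len_gt c)) (leq_addr _ _)).
Qed.

(** Extends a lifted path backwards by one edge. The lift stays in tile [c] unless it starts at the
    first block vertex; then the new vertex is the last inner one of [c'], and the final block of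
    [c'] replaces the initial block of [c]. *)
Let nrm_pred c i c' j : j < len c -> i.+1 < n + len c' ->
  nrm c' i.+1 = nrm c j ->
  exists c1 j1, [/\ j1 < len c1, nrm c' i = nrm c1 j1
    & forall t, t.+1 < n -> nrm c1 (j1 + t.+1) = nrm c (j + t)].
Proof.
move=> jc ic; have lc := len_gt c; have lc' := len_gt c'.
have [nj|jn] := leqP n j.
  rewrite (nrm_inner nj jc); have [i_n|ni] := ltnP i.+1 n.
    by rewrite nrm_block.
  have [il|li] := ltnP i.+1 (len c').
    rewrite nrm_inner // => -[-> ij]; exists c, i; split=> //; first by lia.
    by move=> t _; congr nrm; lia.
  by rewrite -(subnKC li) nrm_last.
rewrite (nrm_block c jn).
have [i_n|ni] := ltnP i.+1 n.
  rewrite nrm_block // => -[ij]; exists c, i; split; first by lia.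
    by rewrite !nrm_block //; lia.
  by move=> t _; congr nrm; lia.
have [il|li] := ltnP i.+1 (len c'); first by rewrite nrm_inner.
rewrite -(subnKC li) nrm_last => -[ij].
have [j0|j0] := posnP j; last first.
  exists c, j.-1; split; first by lia.
    have -> : i = len c' + j.-1 by lia.
    by rewrite nrm_last nrm_block //; lia.
  by move=> t _; congr nrm; lia.
have {ij} ij : i.+1 = len c'.
  by apply/eqP; rewrite eqn_leq li andbT -subn_eq0 ij j0.
exists c', i; split=> //; first by rewrite -ij.
move=> t tn; have -> : i + t.+1 = len c' + t by rewrite -ij addSnnS.
by rewrite j0 nrm_last add0n nrm_block // ltnW.
Qed.

(** A path with at most [n] vertices fits in a single tile: built backwards, it changes tile only
    when all vertices found so far lie in the common block. *)
Let path_lift (x0 : two_tiles n p q) s : 0 < size s <= n ->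
  sorted (@two_tiles_edge n p q) s ->
  exists c j, j < len c /\
    forall t, t < size s -> nrmv (repr (nth x0 s t)) = nrm c (j + t).
Proof.
elim: s => // x [_|y s IH] /andP[_ sn].
  move=> _; have [c [t [tc e]]] := vertexP (repr x).
  have [tl|lt] := ltnP t (len c).
    exists c, t; split=> // -[|//] _.
    by rewrite /= e nrmv_vertex // addn0.
  (* A vertex of the final block is represented in the initial block, which ensures [j < len c]. *)
  exists c, (t - len c); have lc := len_gt c; split; first by lia.
  move=> [|//] _; rewrite /= e nrmv_vertex // addn0.
  by rewrite -{1}(subnKC lt) nrm_last nrm_block //; lia.
move=> /= /andP[/existsP[u /existsP[v /and3P[uv /eqP ux /eqP vy]]] ys].
have [|c [j [jc IHs]]] := IH _ ys; first by move: sn => /=; lia.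
have [c' [i [ic eu ev]]] := edgeP uv.
have [|c1 [j1 [j1c ei ej]]] := nrm_pred jc ic.
  by have := IHs 0 isT; rewrite /= addn0 -vy nrmv_repr ev nrmv_vertex.
exists c1, j1; split=> // -[_|t ts].
  by rewrite /= addn0 -ux nrmv_repr eu nrmv_vertex //; lia.
by rewrite ej; [rewrite /= IHs | move: sn ts => /=; lia].
Qed.

(** The block is labelled by [u] and the inside of each tile by its loop. By [path_lift], a path of
    [L] vertices reads a window of one loop. *)
Lemma loops_respects u : 0 < L <= n -> loop_at n u p -> loop_at n u q ->
  exists g : two_tiles n p q -> 'I_b, respects w g.
Proof.
move=> /andP[L0 Ln] up uq.
have /choice[a Ha] : forall c, exists a : nat -> 'I_b,
    [/\ forall t, t < n -> a t = u t, forall t, t < n -> a (len c + t) = u t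
      & forall j, j < len c -> avoids a j] by case.
pose G (x : option bool * nat) := if x.1 is Some c then a c x.2 else u x.2.
have Ga c t : t < n + len c -> G (nrm c t) = a c t.
  move=> tc; have [a0 a1 _] := Ha c.
  have [tn|nt] := ltnP t n; first by rewrite nrm_block // /G /= a0.
  have [tl|lt] := ltnP t (len c); first by rewrite nrm_inner.
  by rewrite -(subnKC lt) nrm_last /G /= a1 //; lia.
exists (fun x => G (nrmv (repr x))) => i s si sorts sw.
pose x0 := \pi_(two_tiles n p q) (vertex true 0).
have sL : size s = L by rewrite si sizew.
have [|c [j [jc jE]]] := path_lift x0 _ sorts; first by rewrite sL L0.
have [_ _ av] := Ha c; apply: (av j jc i); rewrite -[RHS]sw.
apply: (@eq_from_nth _ (u 0)) => [|t]; first by rewrite size_map size_mkseq si.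
rewrite size_mkseq -si => ts; rewrite nth_mkseq -?si // (nth_map x0) //.
by rewrite jE // Ga //; lia.
Qed.

End Graph.

End Loops.

(** * Clopen markers *)

Section Markers.
Set Implicit Arguments.
Unset Strict Implicit.
Unset Printing Implicit Defensive.
Local Open Scope classical_set_scope.
Local Open Scope ring_scope.

(** Each of the finitely many nonzero times below [N] in absolute value fails to be a period of [x]
    at some coordinate, and a large enough window sees all these failures. *)
Lemma aperiodic_cylinder N (x : fullshift 2) : free_part x ->
  exists r, forall (y : fullshift 2) s, agree r x y -> agree r x (shift s y) ->
    s != 0 -> (N <= `|s|)%N.
Proof.
move=> Fx; elim: N => [|N [r IH]]; first by exists 0%N.
have diff s : s != 0 -> exists p : int, x (p + s) <> x p.
  move=> s0; apply: contrapT => same; apply: (Fx s s0); apply/funext => p.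
  by apply: contrapT => e; apply: same; exists p.
have [N0|N0] := posnP N.
  exists 0%N => y s _ _; lia.
have [|p ep] := diff N%:Z; first by lia.
have [|p' ep'] := diff (- N%:Z); first by lia.
exists (maxn r (maxn `|p| `|p'| + N)) => y s xy xsy s0.
have := IH y s (agree_le (leq_maxl _ _) xy) (agree_le (leq_maxl _ _) xsy) s0.
rewrite leq_eqVlt => /orP[/eqP sN|//].
have [sE|sE] : s = N%:Z \/ s = - N%:Z by lia.
  case: ep; rewrite xy; last by lia.
  by rewrite (xsy p); [rewrite /shift sE|lia].
case: ep'; rewrite xy; last by lia.
by rewrite (xsy p'); [rewrite /shift sE|lia].
Qed.

(* Greedy choice along an enumeration of the cylinders that return to
   themselves only after time [N]. *)
Lemma clopen_markers N : (0 < N)%N -> exists M : set (fullshift 2),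
  [/\ forall x s, M x -> M (shift s x) -> s != 0 -> (N <= `|s|)%N,
      forall x, free_part x -> exists2 s : int, (`|s| < N)%N & M (shift s x)
    & forall x, free_part x -> exists r, forall y, free_part y ->
        agree r x y -> (M x <-> M y)].
Proof.
move=> N0; have [c cP] := cylinder_enum.
pose U i := [set x : fullshift 2 | agree (c i).2 (c i).1 x /\
  forall (y : fullshift 2) s, agree (c i).2 (c i).1 y ->
    agree (c i).2 (c i).1 (shift s y) -> s != 0 -> (N <= `|s|)%N].
pose Mk := fix Mk i : set (fullshift 2) := if i is i'.+1 then
  [set x | Mk i' x \/ U i' x /\ forall s, (`|s| < N)%N -> ~ Mk i' (shift s x)]
  else set0.
have MkS i x : Mk i.+1 x <->
    Mk i x \/ U i x /\ forall s, (`|s| < N)%N -> ~ Mk i (shift s x) by [].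
have Mk_le i j x : (i <= j)%N -> Mk i x -> Mk j x.
  move=> /subnKC <-; elim: (j - i)%N => [|d IH] ix; first by rewrite addn0.
  by rewrite addnS; apply/MkS; left; apply: IH.
have Mk_sep i x s : Mk i x -> Mk i (shift s x) -> s != 0 -> (N <= `|s|)%N.
  elim: i x s => // i IH x s /MkS[ix|[Ux nx]] /MkS[iy|[Uy ny]] s0.
  - exact: IH iy s0.
  - rewrite leqNgt; apply/negP => sN; apply: (ny (- s)); first by rewrite abszN.
    by rewrite shiftD addNr shift0.
  - by rewrite leqNgt; apply/negP => sN; apply: (nx s).
  (* Both points were added at the same stage, so they lie in one cylinder, which returns to itself
     only after time [N]. *)
  - by apply: Ux.2 Uy.1 s0; apply: Ux.1.
have Mk_local i : exists r, forall x y, agree r x y -> (Mk i x <-> Mk i y).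
  elim: i => [|i [r IH]]; first by exists 0%N.
  exists ((c i).2 + r + N)%N => x y xy; rewrite !MkS.
  have UE : U i x <-> U i y.
    have cxy : agree (c i).2 x y by apply: agree_le xy; lia.
    split=> -[ci U2]; split=> //; first exact: agree_trans cxy.
    by apply: agree_trans ci _; apply: agree_sym.
  have ME s : (`|s| < N)%N -> (Mk i (shift s x) <-> Mk i (shift s y)).
    by move=> sN; apply: IH; apply: agree_shift; apply: agree_le xy; lia.
  have M0 := ME 0 N0; rewrite !shift0 in M0.
  split=> -[/M0|[/UE Ux nx]]; [by left|right|by left|right].
    by split=> // s sN /(ME s sN); apply: nx.
  by split=> // s sN /(ME s sN); apply: nx.
have sep x s : (exists i, Mk i x) -> (exists i, Mk i (shift s x)) ->
    s != 0 -> (N <= `|s|)%N.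
  move=> [i ix] [j jx]; apply: (Mk_sep (maxn i j) x).
    by apply: Mk_le ix; rewrite leq_maxl.
  by apply: Mk_le jx; rewrite leq_maxr.
have dense x : free_part x ->
    exists2 s : int, (`|s| < N)%N & exists i, Mk i (shift s x).
  move=> Fx; have [r rx] := aperiodic_cylinder N Fx; have [i ci xi] := cP x r.
  have [[s [sN sx]]|nx] := pselect (exists s, (`|s| < N)%N /\ Mk i (shift s x)).
    by exists s => //; exists i.
  exists 0 => //; rewrite shift0; exists i.+1; apply/MkS; right; split.
    split; rewrite ci; first exact: agree_sym.
    move=> y s cy csy; apply: (rx y); first exact: agree_trans cy.
    exact: agree_trans csy.
  by move=> s sN sx; apply: nx; exists s.
exists [set x | exists i, Mk i x]; split=> // x Fx.
have [[i ix]|nx] := pselect (exists i, Mk i x).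
  have [r rP] := Mk_local i; exists r => y _ /rP xy.
  by split=> _ //; exists i => //; apply/xy.
(* The complement is open as well: an unmarked [x] has a marker at distance less than [N], nearby
   points share that marker, and separation keeps them unmarked. *)
have [s sN [i si]] := dense x Fx; have [r rP] := Mk_local i.
exists (r + N)%N => y _ xy; split=> [/nx//|My]; exfalso.
have s0 : s != 0.
  by apply/eqP => s0; apply: nx; exists i; rewrite -(shift0 x) -s0.
have sy : Mk i (shift s y).
  by apply/(rP (shift s x)) => //; apply: agree_shift; apply: agree_le xy; lia.
by have := sep y s My (ex_intro _ i sy) s0; rewrite leqNgt sN.
Qed.

End Markers.

(** * Coding gaps between markers *)

Section Coding.
Set Implicit Arguments.
Unset Strict Implicit.
Unset Printing Implicit Defensive.
Local Open Scope classical_set_scope.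
Local Open Scope ring_scope.

Lemma agree_eventually (b : nat) (x : fullshift b) (A : set (fullshift b))
    (Q : int -> A -> Prop) (R : nat) :
  (forall j, exists r, forall y : A, agree r x (set_val y) -> Q j y) ->
  exists r, forall y : A, agree r x (set_val y) ->
    forall j, (`|j| <= R)%N -> Q j y.
Proof.
move=> loc; elim: R => [|R [r IH]].
  have [r r0] := loc 0; exists r => y /r0 Q0 j j0.
  by have -> : j = 0 by lia.
have [r1 h1] := loc R.+1%:Z; have [r2 h2] := loc (- R.+1%:Z).
exists (maxn r (maxn r1 r2)) => y xy j jR.
have [jR'|Rj] := leqP `|j| R.
  by apply: IH jR'; apply: agree_le xy; lia.
have [->|->] : j = R.+1%:Z \/ j = - R.+1%:Z by lia.
  by apply: h1; apply: agree_le xy; lia.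
by apply: h2; apply: agree_le xy; lia.
Qed.

Lemma continuous_borel (X Y : topologicalType) (f : X -> Y) :
  continuous f -> borel_map f.
Proof.
move=> /continuousP cf; apply: smallest_sub => /= [|B oB]; last first.
  by apply: sub_sigma_algebra; apply: cf.
have [s0 sC sU] := @smallest_sigma_algebra X setT open.
split=> [|B sB|B sB] /=; first by rewrite preimage_set0.
  exact: (sC _ sB).
by rewrite preimage_bigcup; apply: sU.
Qed.

Let Fshift s (z : free_part) := shift_on free_part_invariant s z.

Let FshiftD s t z : Fshift s (Fshift t z) = Fshift (s + t) z.
Proof. by apply: val_inj => /=; rewrite shiftD. Qed.

(** [k] is the distance back to the last marker, 0 if the origin is one, and [l] the distance to the
    next; the gap around the origin has length [k + l]. *)
Definition gap (M : set (fullshift 2)) (x : fullshift 2) (k l : nat) :=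
  [/\ M (shift (- k%:Z) x), M (shift l%:Z x), (0 < l)%N
    & forall j : int, - k%:Z < j -> j < l%:Z -> ~ M (shift j x)].

Section Gaps.
Variables (M : set (fullshift 2)) (N : nat).
Hypothesis sep : forall x s, M x -> M (shift s x) -> s != 0 -> (N <= `|s|)%N.
Hypothesis dense : forall x, free_part x ->
  exists2 s : int, (`|s| < N)%N & M (shift s x).
Hypothesis loc : forall x, free_part x -> exists r, forall y, free_part y ->
  agree r x y -> (M x <-> M y).

Lemma gap_exists x : free_part x -> exists k l, gap M x k l.
Proof.
move=> Fx.
have prev : exists k : nat, `[< M (shift (- k%:Z) x) >].
  (* A marker at distance less than [N] from position [-N] lies to the left of the origin. *)
  have [s sN Ms] := dense (@free_part_invariant (- N%:Z) _ Fx).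
  exists `|(N%:Z - s)%R|%N; apply/asboolP; move: Ms; rewrite shiftD.
  by congr (M (shift _ x)); lia.
have next : exists l : nat, (0 < l)%N && `[< M (shift l%:Z x) >].
  have [s sN Ms] := dense (@free_part_invariant N%:Z _ Fx).
  exists `|(N%:Z + s)%R|%N; apply/andP; split; first by lia.
  apply/asboolP; move: Ms; rewrite shiftD.
  by congr (M (shift _ x)); lia.
case: (ex_minnP prev) => k /asboolP Mk kmin.
case: (ex_minnP next) => l /andP[l0 /asboolP Ml] lmin.
exists k, l; split=> // j kj jl Mj.
have [j0|j0] : j <= 0 \/ 0 < j by lia.
  have : (k <= `|j|)%N; last by lia.
  by apply: kmin; apply/asboolP; have -> : - `|j|%N%:Z = j by lia.
have : (l <= `|j|)%N; last by lia.
apply: lmin; apply/andP; split; first by lia.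
by apply/asboolP; have -> : `|j|%N%:Z = j by lia.
Qed.

Lemma gap_unique x k l k' l' : gap M x k l -> gap M x k' l' -> k = k' /\ l = l'.
Proof.
move=> [Mk Ml l0 g] [Mk' Ml' l'0 g']; split; apply/eqP; rewrite eqn_leq;
  apply/andP; split; rewrite leqNgt; apply/negP => lt.
- by apply: g Mk'; lia.
- by apply: g' Mk; lia.
- by apply: g Ml'; lia.
- by apply: g' Ml; lia.
Qed.

Lemma gap_long x k l : gap M x k l -> (N <= k + l)%N.
Proof.
move=> [Mk Ml l0 _]; have := sep Mk _ (s := (k + l)%N%:Z); rewrite shiftD.
have -> : (k + l)%N%:Z - k%:Z = l%:Z by lia.
by move=> /(_ Ml); apply; lia.
Qed.

Lemma gap_shift x k l t : gap M x k l -> (t < l)%N ->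
  gap M (shift t%:Z x) (k + t) (l - t).
Proof.
move=> [Mk Ml l0 g] tl; split; rewrite ?shiftD ?subn_gt0 //.
- by have -> : - (k + t)%N%:Z + t%:Z = - k%:Z by lia.
- by have -> : (l - t)%N%:Z + t%:Z = l%:Z by lia.
- by move=> j kj jl; rewrite shiftD; apply: g; lia.
Qed.

Lemma gap_next x k l : free_part x -> gap M x k l ->
  exists l', gap M (shift l%:Z x) 0 l'.
Proof.
move=> Fx [_ Ml l0 _].
have [k' [l' gl]] := gap_exists (@free_part_invariant l%:Z _ Fx); exists l'.
case: k' gl => // k' [_ _ l'0 g]; exfalso; apply: (g 0); rewrite ?shift0 //; lia.
Qed.

Lemma gap_local (z : free_part) k l : gap M (set_val z) k l ->
  exists r, forall z' : free_part, agree r (set_val z) (set_val z') ->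
    gap M (set_val z') k l.
Proof.
move=> [Mk Ml l0 g].
have Mloc j : exists r, forall z' : free_part, agree r (set_val z) (set_val z') ->
    (M (shift j (set_val z)) <-> M (shift j (set_val z'))).
  have Fz (z' : free_part) : free_part (shift j (set_val z')).
    by apply: free_part_invariant; apply: set_mem (valP z').
  have [r rz] := loc (Fz z); exists (r + `|j|)%N => z' zz'.
  by apply: rz => //; apply: agree_shift.
have [r rz] := agree_eventually (k + l) Mloc; exists r => z' /rz zz'.
split=> //; first by apply/zz' => //; lia.
  by apply/zz' => //; lia.
by move=> j kj jl /zz' Mj; apply: (g j) => //; apply: Mj; lia.
Qed.

End Gaps.

(* Consecutive markers at distance [m] are filled with a loop of length [m]
   at [u]. *)
Lemma continuous_of_loops (b k : nat) (w : 'I_k -> seq 'I_b) (L n N : nat)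
    (u : nat -> 'I_b) :
  (forall i, size (w i) = L) -> (L <= n)%N ->
  (forall m, (N <= m)%N -> loop_at (w := w) n u m) ->
  exists f : free_part -> sft w, continuous f /\ equivariant f.
Proof.
(* Gaps of length at least [N] admit loops; gaps longer than [n >= L] let a window meet at most two
   gaps. *)
move=> sizew Ln uloop; pose N' := (maxn N n).+1.
have [M [sep dense loc]] := @clopen_markers N' isT.
have /choice[a Ha] m : exists a : nat -> 'I_b, (N <= m)%N ->
    [/\ forall t, (t < n)%N -> a t = u t,
        forall t, (t < n)%N -> a (m + t)%N = u t
      & forall j, (j < m)%N -> avoids (w := w) a j].
  have [Nm|] := leqP N m; last by exists u.
  by have [a Ha] := uloop m Nm; exists a.
have freeP (z : free_part) : free_part (set_val z) by apply: set_mem (valP z).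
(* [F z] is the letter at the origin: the one at position [k] of the loop chosen for length
   [k + l]. *)
have /choice[F HF] (z : free_part) : exists c, forall k l,
    gap M (set_val z) k l -> c = a (k + l)%N k.
  have [k0 [l0 g0]] := gap_exists dense (freeP z).
  exists (a (k0 + l0)%N k0) => k1 l1 g1.
  by have [-> ->] := gap_unique g0 g1.
have Floc z : exists r, forall z' : free_part,
    agree r (set_val z) (set_val z') -> F z = F z'.
  have [k0 [l0 g0]] := gap_exists dense (freeP z).
  have [r rz] := gap_local loc g0; exists r => z' /rz g'.
  by rewrite (HF _ _ _ g0) (HF _ _ _ g').
pose y z : fullshift b := fun j => F (Fshift j z).
have ysft z : sft w (y z).
  move=> i [j occ]; set z' := Fshift j z.
  have [k0 [l0 g0]] := gap_exists dense (freeP z').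
  have m0N := gap_long sep g0; have l0gt : (0 < l0)%N by case: g0.
  have [|a0 am av] := Ha (k0 + l0)%N; first by lia.
  have ya t : (t < L)%N -> y z (j + t%:Z) = a (k0 + l0)%N (k0 + t)%N.
    move=> tL; rewrite /y addrC -FshiftD -/z'.
    have [tl|lt] := ltnP t l0.
      have /(HF (Fshift t%:Z z')) -> := gap_shift g0 tl.
      by congr (a _ _); lia.
    (* Past the next marker the letters come from the loop of the following gap, which starts with
       the same [u] that continues the current loop. *)
    have [l1 g1] := gap_next dense (freeP z') g0.
    have l1N := gap_long sep g1.
    have tl1 : (t - l0 < l1)%N by lia.
    have := gap_shift g1 tl1; rewrite shiftD add0n.
    have -> : (t - l0)%N%:Z + l0%:Z = t%:Z by lia.
    move=> /(HF (Fshift t%:Z z')) ->; rewrite subnKC; last by lia.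
    have [|a1 _ _] := Ha l1; first by lia.
    by rewrite a1 -?am; [congr (a _ _)|..]; lia.
  apply: (av k0 _ i); first by lia.
  apply: (@eq_from_nth _ (u 0%N)) => [|t]; rewrite size_mkseq // => ti.
  rewrite nth_mkseq // -ya -?(sizew i) // (occ (Ordinal ti)).
  by rewrite (tnth_nth (u 0%N)).
pose f z : sft w := exist _ (y z) (mem_set (ysft z)).
exists f; split; last first.
  move=> s z; apply: val_inj; apply/funext => j /=.
  by rewrite /y /shift -/(Fshift s z) FshiftD.
(* Continuity: each of the finitely many coordinates up to [R] depends on a finite window of [z]. *)
move=> z S /nbhs_set_type[R zR]; apply/nbhs_set_type.
have yloc j : exists r, forall z' : free_part,
    agree r (set_val z) (set_val z') -> y z j = y z' j.
  have [r rz] := Floc (Fshift j z); exists (r + `|j|)%N => z' zz'.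
  by apply: rz; apply: agree_shift.
have [r rz] := agree_eventually R yloc.
by exists r => z' /rz zz'; apply: zR => j /zz'.
Qed.

Lemma borel_loops (b k : nat) (w : 'I_k -> seq 'I_b) (f : free_part -> sft w)
    (n : nat) :
  (0 < b)%N -> borel_map f -> equivariant f ->
  exists (u : nat -> 'I_b) N, forall m, (N <= m)%N -> loop_at (w := w) n u m.
Proof.
move=> b0 bf ef; have [u [N uN]] := borel_recurrence n bf ef.
(* Beyond [n] the word is padded with the letter 0, since [loop_at] reads it only below [n]. *)
pose u' t : 'I_b := if insub t is Some i then u i else Ordinal b0.
have u'E (i : 'I_n) : u' i = u i by rewrite /u' valK.
exists u', N => m /uN[y yu]; exists (fun t => set_val y t%:Z); split.
- move=> t tn; have [yt _] := yu (Ordinal tn).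
  by rewrite -(u'E (Ordinal tn)) in yt.
- move=> t tn; have [_ yt] := yu (Ordinal tn).
  by rewrite -(u'E (Ordinal tn)) in yt.
- move=> j jm i wi; have sy : sft w (set_val y) by apply: set_mem (valP y).
  apply: (sy i); exists j%:Z => t.
  have := congr1 (fun s => nth (Ordinal b0) s t) wi.
  by rewrite (tnth_nth (Ordinal b0)) nth_mkseq.
Qed.

End Coding.

Theorem theorem3p2 (b : nat) (hb : 1 <= b) (k : nat)
    (w : 'I_k.+1 -> seq 'I_b)
    (hw : forall i, 0 < size (w i))
    (hlen : forall i, size (w i) = size (w ord0)) :
  [<-> exists f : free_part -> sft w, borel_map f /\ equivariant f;
       exists f : free_part -> sft w, continuous f /\ equivariant f;
       exists n p q : nat,
         [/\ size (w ord0) <= n, n < p, n < q, gcdn p q = 1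
           & exists g : two_tiles n p q -> 'I_b, respects w g];
       forall n : nat, size (w ord0) <= n ->
         exists N : nat, forall p q : nat,
           N <= p -> N <= q -> n < p -> n < q ->
           exists g : two_tiles n p q -> 'I_b, respects w g].
Proof.
set P1 := (X in all_iff X _); set P2 := (X in all_iff _ [:: X; _; _]).
set P3 := (X in all_iff _ [:: _; X; _]); set P4 := (X in all_iff _ [:: _; _; X]).
have P14 : P1 -> P4.
  move=> [f [bf ef]] n Ln.
  have [u [N loops]] := borel_loops n hb bf ef.
  exists N => p q Np Nq np nq.
  by apply: (loops_respects hlen np nq); [rewrite hw| |]; [|exact: loops..].
have P43 : P4 -> P3.
  move=> h; have [N hN] := h (size (w ord0)) (leqnn _).
  (* Consecutive integers are coprime, so [p] and [p.+1] serve once [p] is large. *)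
  pose p := (maxn N (size (w ord0))).+1.
  exists (size (w ord0)), p, p.+1; split; rewrite /p ?ltnS ?leq_maxr //.
  - by rewrite leqW // leq_maxr.
  - exact/eqP/coprimenS.
  - apply: hN; lia.
have P32 : P3 -> P2.
  move=> [n [p [q [Ln np nq pq [g rg]]]]].
  have [u [up uq]] := respects_loops hlen np nq Ln rg.
  apply: (continuous_of_loops (N := p * q) hlen Ln) => m pqm.
  by apply: (loop_coprime hlen Ln _ _ _ up uq); rewrite // /coprime ?pq //; lia.
have P21 : P2 -> P1.
  by move=> [f [cf ef]]; exists f; split=> //; apply: continuous_borel.
(* The implications above form a cycle opposite to that of the statement, so each goal composes
   three of them. *)
do ![split=> //].
- by move=> /P14 /P43 /P32.
- by move=> /P21 /P14 /P43.
- by move=> /P32 /P21 /P14.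
- by move=> /P43 /P32 /P21.
Qed.
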